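(* There is a Radon probability measure $\nu$ on $\beta\omega$ such that: (i) $\nu$ is of countable type, i.e. $L^1(\nu)$ is separable; (ii) $\nu(\beta\omega\setminus\omega)=1$; (iii) $\nu(F)=0$ for every closed separable set $F\subseteq\beta\omega\setminus\omega$.
   Context: $\omega=\{0,1,2,\dots\}$ with the discrete topology and $\beta\omega$ is its Čech–Stone compactification. *)

(* Defs.v *)
From HB Require Import structures.
From mathcomp Require Import all_boot all_order all_algebra.
From mathcomp Require Import all_classical all_reals all_analysis.
Set Implicit Arguments.
Unset Strict Implicit.
Unset Printing Implicit Defensive.
Import Order.TTheory GRing.Theory Num.Theory.
Local Open Scope classical_set_scope.
Local Open Scope ring_scope.

(** * The Čech–Stone compactification of ω, realised as the Stone space of
    ultrafilters on nat.  A point of βω is an ultrafilter on ω; the basic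
    (clopen) open sets are  Â = [set p | A ∈ p]  for A ⊆ ω; the point n ∈ ω
    is identified with the principal ultrafilter at n. *)

Definition betaomega : Type := {F : set_system nat | UltraFilter F}.

HB.instance Definition _ := gen_eqMixin betaomega.
HB.instance Definition _ := gen_choiceMixin betaomega.

Definition omega_pt (n : nat) : betaomega :=
  exist _ (principal_filter n) (principal_filter_ultra n).

HB.instance Definition _ := isPointed.Build betaomega (omega_pt 0).

Definition bw_base (A : set nat) : set betaomega :=
  [set p | proj1_sig p A].

Lemma bw_base_cover : \bigcup_(A in [set: set nat]) bw_base A = setT.
Proof.
rewrite predeqE => p; split => // _; exists setT => //.
by case: p => F FU; rewrite /bw_base /=; apply: filterT.
Qed.

Lemma bw_base_join (A B : set nat) (t : betaomega) :
  [set: set nat] A -> [set: set nat] B -> bw_base A t -> bw_base B t ->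
  exists C, [/\ [set: set nat] C, bw_base C t & bw_base C `<=` bw_base A `&` bw_base B].
Proof.
move=> _ _; case: t => F FU /= FA FB; exists (A `&` B); split => //.
  by rewrite /bw_base /=; apply: filterI.
move=> [G GU]; rewrite /bw_base /= => GAB; split.
  by apply: filterS GAB => x [].
by apply: filterS GAB => x [].
Qed.

HB.instance Definition _ := isBaseTopological.Build betaomega
  bw_base_cover bw_base_join.

Definition omega_in_bw : set betaomega := range omega_pt.
Definition remainder : set betaomega := ~` omega_in_bw.

Definition BW := g_sigma_algebraType (@open betaomega).

Definition separable_set (T : topologicalType) (A : set T) : Prop :=
  exists D : set T, [/\ D `<=` A, countable D & A `<=` closure D].

Definition radon (R : realType) (nu : {measure set BW -> \bar R}) : Prop :=
  forall B : set BW, measurable B ->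
    nu B = ereal_sup [set nu K | K in
                        [set K : set BW | @compact betaomega K /\ K `<=` B]].

Definition L1_separable (R : realType) (nu : {measure set BW -> \bar R}) : Prop :=
  exists D : set (BW -> R),
    [/\ countable D,
        (forall g, D g -> nu.-integrable [set: BW] (EFin \o g)) &
        (forall f : BW -> R, nu.-integrable [set: BW] (EFin \o f) ->
           forall e : R, 0 < e ->
             exists2 g, D g &
               (\int[nu]_x `|(f x - g x)%:E| < e%:E)%E)].

(* Main.v *)
(** A Radon probability on βω is a finitely additive probability mu on the
    subsets of ω, and it has countable type when some countable family of
    subsets of ω is dense for mu.  We take mu A = λ(Φ A), where λ is Lebesgue
    measure on [1,2) and Φ is a Boolean homomorphism from P(ω) into the measure
    algebra of λ, so that countable type is inherited from λ.

    Identify ω with the vertices of the binary tree and [1,2) with its branches.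
    Sending A to the set Φ0 A of branches that meet A infinitely often preserves
    finite unions.  Since the measure algebra is complete, Zorn's lemma gives a
    minimal union-preserving Φ below Φ0, and minimality makes Φ a homomorphism.
    Singletons are mapped to 0, so the measure lives on the remainder.

    Given ultrafilters p_k in the remainder and m, each p_k contains the set of
    descendants of some vertex j_k of level k+m+1.  The union A of these sets
    lies in every p_k, and Φ0 A is covered by the dyadic intervals of the j_k,
    so mu A <= 2^-m.  Hence the closure of {p_k} is null. *)

Require Import Defs.
From HB Require Import structures.
From mathcomp Require Import all_boot all_order all_algebra.
From mathcomp Require Import all_classical all_reals all_analysis.
From mathcomp Require Import measurable_realfun lra.
Set Implicit Arguments.
Unset Strict Implicit.
Unset Printing Implicit Defensive.
Import Order.TTheory GRing.Theory Num.Theory.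
Local Open Scope classical_set_scope.
Local Open Scope ring_scope.

(** * Minimal join homomorphisms into the measure algebra *)

Section AlmostInclusion.
Context (d : measure_display) (T : measurableType d) (R : realType).
Variable P : probability T R.
Implicit Types A B C D E F : set T.

(** The order of the measure algebra, handled on representatives; negligibility rather than measure
    zero lets it apply to sets not known to be measurable. *)
Definition aesub A B := P.-negligible (A `\` B).

Lemma aesubS A B : A `<=` B -> aesub A B.
Proof. by rewrite -setD_eq0 /aesub => ->; exact: negligible_set0. Qed.

Lemma aesub1 A B C D : aesub A B -> C `\` D `<=` A `\` B -> aesub C D.
Proof. by move=> AB CD; apply: negligibleS AB. Qed.

Lemma aesub2 A B C D E F : aesub A B -> aesub C D ->
  E `\` F `<=` (A `\` B) `|` (C `\` D) -> aesub E F.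
Proof. by move=> AB CD EF; apply: negligibleS EF _; exact: negligibleU. Qed.

Lemma aesub_trans A B C : aesub A B -> aesub B C -> aesub A C.
Proof.
move=> AB BC; apply: (aesub2 AB BC) => x [Ax nCx].
by have [Bx|nBx] := pselect (B x); [right|left].
Qed.

Lemma aesubUl A B C : aesub A C -> aesub B C -> aesub (A `|` B) C.
Proof. by move=> hA hB; apply: (aesub2 hA hB) => x [[?|?] ?]; [left|right]. Qed.

Lemma aesub_bigcapr A (F : (set T)^nat) :
  (forall n, aesub A (F n)) -> aesub A (\bigcap_n F n).
Proof.
by move=> AF; rewrite /aesub setDE setC_bigcap setI_bigcupr; exact: negligible_bigcup.
Qed.

Lemma le_measure_aesub A B :
  measurable A -> measurable B -> aesub A B -> (P A <= P B)%E.
Proof.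
move=> mA mB /measure_negligible AB0.
rewrite (measureDI _ mA mB) AB0 ?add0e; last exact: measurableD.
exact: measureIr.
Qed.

Lemma measure_aesub_eq A B :
  measurable A -> measurable B -> aesub A B -> aesub B A -> P A = P B.
Proof.
by move=> mA mB AB BA; apply/eqP; rewrite eq_le !le_measure_aesub.
Qed.

(** Completeness of the measure algebra for arbitrary, possibly uncountable, families. Some
    countable intersection of members of [S] attains the infimum of the measures of such
    intersections, so intersecting it with a further member loses no mass. *)
Lemma essential_infimum (S : set (set T)) : (forall A, S A -> measurable A) ->
  exists M, [/\ measurable M, (forall A, S A -> aesub M A) &
    (forall N, (forall A, S A -> aesub N A) -> aesub N M)].
Proof.
move=> mS.
have [[A0 SA0]|S0] := pselect (S !=set0); last first.
  exists setT; split => [//|A SA|N _]; first by case: S0; exists A.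
  exact: aesubS.
pose V := [set P (\bigcap_n f n) | f in [set f : (set T)^nat | forall n, S (f n)]].
have V0 : lbound V 0 by move=> _ [f _ <-].
have fV : ereal_inf V \is a fin_num.
  rewrite fin_real//; apply/andP; split.
    by rewrite (@lt_le_trans _ _ 0%E)//; exact: le_ereal_inf_tmp.
  apply: (@le_lt_trans _ _ (P (\bigcap_(n in [set: nat]) A0))).
    by apply: ereal_inf_lbound; exists (fun=> A0).
  by rewrite ltey_eq fin_num_measure//; apply: bigcapT_measurable => _; exact: mS.
have /choice[f fP] (k : nat) : exists f : (set T)^nat, (forall n, S (f n)) /\
    (P (\bigcap_n f n) < ereal_inf V + k.+1%:R^-1%:E)%E.
  have k0 : 0 < k.+1%:R^-1 :> R by rewrite invr_gt0.
  have [_ [f Sf <-] lt] := lb_ereal_inf_adherent k0 fV.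
  by exists f.
pose g m := let kn := odflt (0%N, 0%N) (unpickle m) in f kn.1 kn.2.
have Sg m : S (g m) by exact: (fP _).1.
have mg : measurable (\bigcap_n g n) by apply: bigcapT_measurable => n; exact: mS.
have PM : (P (\bigcap_n g n) <= ereal_inf V)%E.
  apply/lee_addgt0Pr => e e0.
  have [k] := ltr_add_invr e0; rewrite add0r => ke.
  apply: (@le_trans _ _ (P (\bigcap_n f k n))).
    apply: le_measure; rewrite ?inE//.
      by apply: bigcapT_measurable => n; apply/mS/(fP _).1.
    move=> x gx n _; have := gx (pickle (k, n)) I.
    by rewrite /g pickleK.
  by apply/ltW/(lt_le_trans (fP k).2); rewrite leeD2l// lee_fin ltW.
exists (\bigcap_n g n); split => // [A SA|N NS]; last first.
  by apply: aesub_bigcapr => n; exact: NS.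
have mA := mS _ SA.
apply/negligibleP; first exact: measurableD.
have : (ereal_inf V <= P (\bigcap_n g n `&` A))%E.
  apply: ereal_inf_lbound; exists (fun n => if n is m.+1 then g m else A) => [[|n]//=|].
  congr (P _); rewrite eqEsubset; split => [x hx|x [gx Ax] [|n] _//=].
    by split; [move=> n _; exact: (hx n.+1)|exact: (hx 0%N)].
  exact: gx.
move=> /(le_trans PM) le; apply/eqP.
by rewrite -measure_le0; rewrite measureD ?sube_le0// ltey_eq fin_num_measure.
Qed.
End AlmostInclusion.

Section JoinHomomorphism.
Context (d : measure_display) (T : measurableType d) (R : realType).
Variable P : probability T R.
Local Notation aesub := (aesub P).
Variables (I : Type) (Phi0 : set I -> set T).
Hypothesis mPhi0 : forall A, measurable (Phi0 A).
Hypothesis Phi0U : forall A B, Phi0 (A `|` B) = Phi0 A `|` Phi0 B.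
Hypothesis Phi0T : Phi0 setT = setT.

(** The last two clauses together say that unions are preserved almost everywhere. They are split
    into inclusions so that each can be checked against a greatest lower bound. *)
Definition join_hom_below (Phi : set I -> set T) :=
  [/\ forall A, measurable (Phi A), forall A, aesub (Phi A) (Phi0 A),
      aesub setT (Phi setT),
      forall A B, aesub (Phi A) (Phi (A `|` B)) &
      forall A B, aesub (Phi (A `|` B)) (Phi A `|` Phi B)].

(** Zorn's lemma applies because a nonempty chain has its pointwise essential infimum as a lower
    bound. *)
Lemma minimal_join_hom : exists Phi, join_hom_below Phi /\
  forall Psi, join_hom_below Psi -> (forall A, aesub (Psi A) (Phi A)) ->
    forall A, aesub (Phi A) (Psi A).
Proof.
(* The order is reversed, since [ZL_preorder] yields maximal elements. *)
pose rel (f g : {classic {Phi | join_hom_below Phi}}) :=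
  `[< forall A, aesub (sval g A) (sval f A) >].
have h0 : join_hom_below Phi0.
  split => // [A||A B|A B]; first exact: aesubS.
  - by rewrite Phi0T; exact: aesubS.
  - by rewrite Phi0U; apply: aesubS => x; left.
  - by rewrite Phi0U; exact: aesubS.
have [|r s t /asboolP rs /asboolP st||f fmin] :=
    @ZL_preorder {classic {Phi | join_hom_below Phi}} (exist _ _ h0) rel.
- by move=> f; apply/asboolP => A; exact: aesubS.
- by apply/asboolP => A; exact: aesub_trans (st A) (rs A).
- move=> C Ctot.
  have [[f0 Cf0]|C0] := pselect (C !=set0); last first.
    by exists (exist _ _ h0) => s Cs; case: C0; exists s.
  have /choice[Psi PsiP] (A : set I) : exists M : set T, [/\ measurable M,
      (forall f, C f -> aesub M (sval f A)) &
      (forall N, (forall f, C f -> aesub N (sval f A)) -> aesub N M)].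
    have [|M [mM lM gM]] := @essential_infimum _ _ _ P [set sval f A | f in C].
      by move=> _ [f Cf <-]; case: (svalP f).
    exists M; split => // [f Cf|N NC]; first by apply: lM; exists f.
    by apply: gM => _ [f Cf <-]; exact: NC.
  have hPsi : join_hom_below Psi.
    split => [A|A||A B|A B].
    + by have [] := PsiP A.
    + have [_ + _] := PsiP A => /(_ _ Cf0) /aesub_trans; apply.
      by case: (svalP f0).
    + have [_ _] := PsiP setT; apply => f Cf.
      by case: (svalP f).
    + have [_ _] := PsiP (A `|` B); apply => f Cf.
      have [_ + _] := PsiP A => /(_ _ Cf) /aesub_trans; apply.
      by case: (svalP f).
    + (* By directedness, one member of the chain serves both A and B. *)
      have key f g : C f -> C g ->
          aesub (Psi (A `|` B)) (sval f A `|` sval g B).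
        move=> Cf Cg.
        have [h [Ch hf hg]] : exists h,
            [/\ C h, aesub (sval h A) (sval f A) & aesub (sval h B) (sval g B)].
          have [/asboolP fg|/asboolP gf] := Ctot _ _ Cf Cg.
            by exists g; split => //; exact: aesubS.
          by exists f; split => //; exact: aesubS.
        have [_ + _] := PsiP (A `|` B) => /(_ _ Ch) /aesub_trans; apply.
        have [_ _ _ _ /(_ A B) /aesub_trans] := svalP h; apply.
        apply: (aesub2 hf hg) => x [[?|?] /not_orP[? ?]]; [by left|by right].
      (* The greatest lower bound is taken one variable at a time, first over [g] with [f] fixed,
         then over [f]; subtracting a set turns a bound by a union into a bound by a single
         value. *)
      have keyB f : C f -> aesub (Psi (A `|` B) `\` sval f B) (Psi A).
        move=> Cf; have [_ _] := PsiP A; apply => g Cg.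
        by apply: (aesub1 (key g f Cg Cf)) => x [[? ?] ?]; split => // -[].
      have : aesub (Psi (A `|` B) `\` Psi A) (Psi B).
        have [_ _] := PsiP B; apply => f Cf.
        by apply: (aesub1 (keyB f Cf)) => x [[? ?] ?].
      by move=> h; apply: (aesub1 h) => x [? /not_orP[? ?]].
  by exists (exist _ _ hPsi) => s Cs; apply/asboolP => A; have [_ + _] := PsiP A; exact.
- exists (sval f); split; first exact: svalP.
  move=> Psi hPsi le A.
  by have /asboolP := fmin (exist _ _ hPsi) (asboolT le); exact.
Qed.

(* If Phi is minimal, it equals A |-> Phi (A & B) u (Phi A \ Phi B), which is
   again a join homomorphism below it; comparing them inside Phi B gives that
   Phi preserves intersections. *)
Lemma boolean_hom_below : exists Phi, join_hom_below Phi /\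
  forall A B, aesub (Phi A `&` Phi B) (Phi (A `&` B)).
Proof.
have [Phi [hPhi Pmin]] := minimal_join_hom.
exists Phi; split => // A B.
have [mPhi PhiPhi0 PhiT PhiS PhiU] := hPhi.
have mono C D : C `<=` D -> aesub (Phi C) (Phi D).
  by move=> CD; rewrite -(setUidr CD); exact: PhiS.
pose Psi C := Phi (C `&` B) `|` (Phi C `\` Phi B).
have PsiPhi C : aesub (Psi C) (Phi C).
  by apply: aesubUl; [exact: mono|exact: aesubS].
have hPsi : join_hom_below Psi.
  split => [C|C||C D|C D].
  - by apply: measurableU => //; exact: measurableD.
  - exact: aesub_trans (PsiPhi C) (PhiPhi0 C).
  - rewrite /Psi setTI; apply: (aesub1 PhiT) => x [_ /not_orP[nB nT]].
    by split => // xT; apply: nT; split.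
  - have h1 : aesub (Phi (C `&` B)) (Phi ((C `|` D) `&` B)).
      by apply: mono => x [? ?]; split => //; left.
    apply: (aesub2 h1 (PhiS C D)) => x [[?|[? ?]] /not_orP[? h]]; first by left.
    by right; split => // ?; apply: h.
  - have := PhiU (C `&` B) (D `&` B); rewrite -setIUl => h.
    apply: (aesub2 h (PhiU C D)) => x.
    rewrite /Psi /setU /setD /=; have := EM (Phi B x); tauto.
apply: (aesub1 (Pmin _ hPsi PsiPhi A)) => x [[? ?] ?]; split => // -[//|[]//].
Qed.

End JoinHomomorphism.

(** * Separability of the measure algebra *)

Section MeasureAlgebraSeparable.
Context (d : measure_display) (T : measurableType d) (R : realType).
Variable P : probability T R.
Implicit Types A B : set T.

Lemma measurableY A B : measurable A -> measurable B -> measurable (A `+` B).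
Proof. by move=> mA mB; apply: measurableU; exact: measurableD. Qed.

Lemma measureY_triangle A B C : measurable A -> measurable B -> measurable C ->
  (P (A `+` C) <= P (A `+` B) + P (B `+` C))%E.
Proof.
move=> mA mB mC; apply: le_trans (measureU2 _ _ _); [|exact: measurableY..].
apply: le_measure; rewrite ?inE; [exact: measurableY| |].
  by apply: measurableU; exact: measurableY.
by move=> x; rewrite /setY /setU /setD /=; have := EM (B x); tauto.
Qed.

Lemma measureYU A B C D :
  measurable A -> measurable B -> measurable C -> measurable D ->
  (P ((A `|` B) `+` (C `|` D)) <= P (A `+` C) + P (B `+` D))%E.
Proof.
move=> mA mB mC mD; apply: le_trans (measureU2 _ _ _); [|exact: measurableY..].
apply: le_measure; rewrite ?inE.
- by apply: measurableY; exact: measurableU.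
- by apply: measurableU; exact: measurableY.
- by move=> x; rewrite /setY /setU /setD /=; tauto.
Qed.

Variable G : (set T)^nat.
Hypothesis genG : @measurable d T = <<s range G>>.

(* The algebra generated by G, coded by the countable type of finite trees;
   an inner node denotes the complement of the union of its children. *)
Fixpoint nor_tree (t : GenTree.tree nat) : set T :=
  match t with
  | GenTree.Leaf n => G n
  | GenTree.Node _ ts => ~` foldr (fun u acc => nor_tree u `|` acc) set0 ts
  end.

Let mG n : measurable (G n).
Proof. by rewrite genG; apply: sub_sigma_algebra; exists n. Qed.

Lemma measurable_nor_tree t : measurable (nor_tree t).
Proof.
move: t; fix IH 1 => -[n|k ts]; first exact: mG.
apply: measurableC; elim: ts => [|u ts IHts]; first exact: measurable0.
by apply: measurableU; [exact: IH|exact: IHts].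
Qed.

Definition tree_approximable A := measurable A /\
  forall e : R, 0 < e -> exists t, (P (A `+` nor_tree t) < e%:E)%E.

Lemma tree_approximable0 : tree_approximable set0.
Proof.
split=> // e e0; exists (GenTree.Node 0 [:: GenTree.Node 0 [::]]).
by rewrite /= setU0 setCK setYK measure0 lte_fin.
Qed.

Lemma tree_approximableC A : tree_approximable A -> tree_approximable (~` A).
Proof.
move=> [mA hA]; split=> [|e /hA[t ht]]; first exact: measurableC.
exists (GenTree.Node 0 [:: t]); rewrite /= setU0.
apply: le_lt_trans ht; apply: le_measure; rewrite ?inE.
- by apply: measurableY; apply: measurableC => //; exact: measurable_nor_tree.
- by apply: measurableY => //; exact: measurable_nor_tree.
- by move=> x; rewrite /setY /setU /setD /setC /=; have := EM (A x);
    have := EM (nor_tree t x); tauto.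
Qed.

Lemma tree_approximableU A B :
  tree_approximable A -> tree_approximable B -> tree_approximable (A `|` B).
Proof.
move=> [mA hA] [mB hB]; split=> [|e e0]; first exact: measurableU.
have e2 : 0 < e / 2 by rewrite divr_gt0.
have [t ht] := hA _ e2; have [u hu] := hB _ e2.
exists (GenTree.Node 0 [:: GenTree.Node 0 [:: t; u]]).
rewrite /= !setU0 setCK [e]splitr EFinD.
apply: (le_lt_trans _ (lteD ht hu)).
by apply: measureYU => //; exact: measurable_nor_tree.
Qed.

(** Finite subunions exhaust the union, so by continuity from above one of them misses less than
    [e / 2]; that finite union is then approximated within [e / 2]. *)
Lemma tree_approximable_bigcup (F : (set T)^nat) :
  (forall n, tree_approximable (F n)) -> tree_approximable (\bigcup_n F n).
Proof.
move=> hF; have mF n : measurable (F n) by case: (hF n).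
split=> [|e e0]; first exact: bigcupT_measurable.
have e2 : 0 < e / 2 by rewrite divr_gt0.
pose B n := \big[setU/set0]_(i < n) F i.
have hB n : tree_approximable (B n).
  rewrite /B; elim: n => [|n IH]; first by rewrite big_ord0; exact: tree_approximable0.
  by rewrite big_ord_recr; exact: tree_approximableU.
have mB n : measurable (B n) by case: (hB n).
have BF n : B n `<=` \bigcup_n F n by exact: bigsetU_bigcup.
have mU : measurable (\bigcup_n F n) by exact: bigcupT_measurable.
have Bcap : \bigcap_n (\bigcup_n F n `\` B n) = set0.
  rewrite -subset0 => x hx; have [[i _ Fix] _] := hx 0%N I.
  have [_] := hx i.+1 I; apply; rewrite /B -bigcup_mkord.
  by exists i => //=.
have [n hn] : exists n, (P (\bigcup_n F n `\` B n) < (e / 2)%:E)%E.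
  have := @nonincreasing_cvg_mu _ _ _ P (fun n => \bigcup_n F n `\` B n).
  rewrite Bcap measure0 => h.
  have /fine_cvgP[_ /cvgr_lt] : P (\bigcup_n F n `\` B n) @[n --> \oo] --> 0%E.
    apply: h => [|n|//|].
    - by rewrite ltey_eq fin_num_measure//; exact: measurableD.
    - exact: measurableD.
    - by move=> m n mn; apply/subsetPset; apply: setDS; exact: (@subset_bigsetU _ F).
  move=> /(_ _ e2)[n _ /(_ n (leqnn n)) /= hn]; exists n.
  by rewrite -[ltLHS]fineK ?lte_fin// fin_num_measure//; exact: measurableD.
have [t ht] := (hB n).2 _ e2; exists t.
rewrite [e]splitr EFinD; apply: le_lt_trans (lteD hn ht).
apply: le_trans (measureY_triangle _ (mB n) _) _ => //; first exact: measurable_nor_tree.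
apply: leeD => //; rewrite le_measure ?inE//; [exact: measurableY|exact: measurableD|].
by move=> x [//|[/BF]].
Qed.

(** The approximable sets form a sigma-algebra containing the generators, and there are only
    countably many trees to approximate them by. *)
Lemma measure_algebra_separable : exists E : (set T)^nat,
  (forall n, measurable (E n)) /\
  forall A, measurable A -> forall e : R, 0 < e ->
    exists n, (P (A `+` E n) < e%:E)%E.
Proof.
have sub : measurable `<=` tree_approximable.
  rewrite genG; apply: smallest_sub => [|_ [n _ <-]]; last first.
    split; first exact: mG.
    by move=> e e0; exists (GenTree.Leaf n); rewrite /= setYK measure0 lte_fin.
  split; first exact: tree_approximable0.
  - by move=> A /tree_approximableC; rewrite setTD.
  - exact: tree_approximable_bigcup.
exists (fun n => odflt set0 (omap nor_tree (unpickle n))); split => [n|A mA e e0].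
  by case: unpickle => [t|]/=; [exact: measurable_nor_tree|exact: measurable0].
have [_ /(_ _ e0)[t ht]] := sub _ mA.
by exists (pickle t); rewrite pickleK.
Qed.

End MeasureAlgebraSeparable.

(** * From charges on ω to Radon measures on βω *)

Section BetaOmega.
Implicit Types (A B : set nat) (U V K : set betaomega).

Lemma bw_baseT : bw_base setT = setT.
Proof. by apply/seteqP; split => // -[F FU] _; exact: filterT. Qed.

Lemma bw_base0 : bw_base set0 = set0.
Proof. by apply/seteqP; split => // -[F FU]; exact: filter_not_empty. Qed.

Lemma bw_baseI A B : bw_base (A `&` B) = bw_base A `&` bw_base B.
Proof.
apply/seteqP; split => -[F FU]; rewrite /bw_base /=; last by case; exact: filterI.
by move=> FAB; split; apply: filterS FAB => x [].
Qed.

Lemma bw_baseC A : bw_base (~` A) = ~` bw_base A.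
Proof.
apply/seteqP; split => -[F FU]; rewrite /bw_base /=.
  move=> FnA FA; apply: (@filter_not_empty _ F).
  by rewrite -(setICr A); exact: filterI.
by have [] := in_ultra_setVsetC A FU.
Qed.

Lemma bw_baseU A B : bw_base (A `|` B) = bw_base A `|` bw_base B.
Proof. by rewrite -[A `|` B]setCK setCU bw_baseC bw_baseI !bw_baseC -setCU setCK. Qed.

Lemma bw_baseD A B : bw_base (A `\` B) = bw_base A `\` bw_base B.
Proof. by rewrite setDE bw_baseI bw_baseC -setDE. Qed.

Lemma bw_base_omega_pt A n : bw_base A (omega_pt n) = A n.
Proof. by rewrite /bw_base /= propeqE; exact: principal_filterP. Qed.

Lemma bw_base_sub A B : bw_base A `<=` bw_base B -> A `<=` B.
Proof. by move=> AB n; have := AB (omega_pt n); rewrite !bw_base_omega_pt. Qed.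

Lemma bw_base_mono A B : A `<=` B -> bw_base A `<=` bw_base B.
Proof. by move=> AB [F FU]; exact: filterS. Qed.

Lemma bw_open A : open (bw_base A).
Proof. by exists [set A]; [|rewrite bigcup_set1]. Qed.

Lemma bw_closed A : closed (bw_base A).
Proof. by rewrite -[A]setCK bw_baseC; apply: open_closedC; exact: bw_open. Qed.

Lemma bw_openP U : open U ->
  forall p, U p -> exists2 A, bw_base A p & bw_base A `<=` U.
Proof.
by move=> [D _ <-] p [A DA Ap]; exists A => // q Aq; exists A.
Qed.

(** An ultrafilter [F] on βω converges to the point [G] made of those A whose basic set belongs to
    [F]; that [G] is an ultrafilter follows from the Boolean identities for [bw_base]. *)
Lemma bw_compact : compact [set: betaomega].
Proof.
rewrite compact_ultra => F FU _.
pose G : set_system nat := [set A | F (bw_base A)].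
have GE A : G A = F (bw_base A) by [].
have GU : UltraFilter G.
  split.
    apply: Build_ProperFilter_ex.
      move=> A GA; apply: contrapT => /forallNP nA.
      have A0 : A = set0 by rewrite -subset0 => n /nA.
      by apply: (@filter_not_empty _ F); rewrite -bw_base0 -A0.
    split; first by rewrite GE bw_baseT; exact: filterT.
      by move=> A B; rewrite !GE bw_baseI; exact: filterI.
    by move=> A B /bw_base_mono; rewrite !GE; exact: filterS.
  move=> H HP GH; apply/seteqP; split => // A HA.
  have [//|] := in_ultra_setVsetC (bw_base A) FU.
  rewrite -bw_baseC => /GH HnA; exfalso; apply: (@filter_not_empty _ H).
  by rewrite -(setICr A); exact: filterI.
exists (exist _ G GU); split => // W.
rewrite nbhsE => -[U [oU Up] UW].
have [A GA AU] := bw_openP oU Up.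
by apply: (@filterS _ F _ (bw_base A)) => //; exact: subset_trans UW.
Qed.

Lemma bw_closed_compact K : closed K -> compact K.
Proof. by move=> cK; apply: (subclosed_compact cK bw_compact). Qed.

(** Finitely many basic sets inside [U] cover the compact [K], and a finite union of basic sets is
    basic. *)
Lemma bw_separation K U : closed K -> open U -> K `<=` U ->
  exists2 A, K `<=` bw_base A & bw_base A `<=` U.
Proof.
move=> /bw_closed_compact; rewrite compact_cover => cK oU KU.
have [|p Kp|D' D'U KD'] := cK _ [set A | bw_base A `<=` U] bw_base.
- by move=> A _; exact: bw_open.
- by have [A Ap AU] := bw_openP oU (KU p Kp); exists A.
have baseE (s : seq (set nat)) :
    bw_base (\big[setU/set0]_(A <- s) A) = \big[setU/set0]_(A <- s) bw_base A.
  exact: (big_morph _ bw_baseU bw_base0).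
exists (\big[setU/set0]_(A <- finmap.enum_fset D') A); rewrite baseE -bigcup_fset.
  by move=> p /KD'.
by move=> p [A /= AD' Ap]; have := D'U _ AD'; rewrite inE; apply.
Qed.

End BetaOmega.

(** * The Radon measure on βω defined by a finitely additive probability on ω *)

Section StoneRepresentation.
Variables (R : realType) (mu : set nat -> R).
Hypothesis mu_ge0 : forall A, 0 <= mu A.
Hypothesis muT : mu setT = 1.
Hypothesis muU : forall A B, A `&` B = set0 -> mu (A `|` B) = mu A + mu B.
Implicit Types (A B : set nat) (U V S : set betaomega).

Lemma charge_le A B : A `<=` B -> mu A <= mu B.
Proof.
by move=> AB; rewrite -(setDUK AB) muU ?lerDl// setDE setICA setICr setI0.
Qed.

Definition open_mass U : \bar R :=
  ereal_sup [set (mu A)%:E | A in [set A | bw_base A `<=` U]].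

Definition bw_outer S : \bar R :=
  ereal_inf [set open_mass U | U in [set U | open U /\ S `<=` U]].

Lemma charge0 : mu set0 = 0.
Proof.
apply/eqP; have := muU (set0I (@set0 nat)); rewrite setU0 => /eqP.
by rewrite -subr_eq0 opprD addrA subrr add0r oppr_eq0.
Qed.

Lemma charge_le1 A : mu A <= 1.
Proof. by rewrite -muT charge_le. Qed.

Lemma le_open_mass U V : U `<=` V -> (open_mass U <= open_mass V)%E.
Proof.
by move=> UV; apply: ereal_sup_le => _ [A AU <-]; exists A => //; exact: subset_trans UV.
Qed.

Lemma charge_open_mass A U : bw_base A `<=` U -> ((mu A)%:E <= open_mass U)%E.
Proof. by move=> AU; apply: ereal_sup_ubound; exists A. Qed.

Lemma open_mass_ge0 U : (0 <= open_mass U)%E.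
Proof.
by apply: le_trans (@charge_open_mass set0 U _); [rewrite charge0|rewrite bw_base0].
Qed.

Lemma open_mass_base A : open_mass (bw_base A) = (mu A)%:E.
Proof.
apply/eqP; rewrite eq_le charge_open_mass// andbT; apply: ge_ereal_sup => _ [B BA <-].
by rewrite lee_fin charge_le//; exact: bw_base_sub.
Qed.

Lemma open_mass_le1 U : (open_mass U <= 1)%E.
Proof. by apply: ge_ereal_sup => _ [A _ <-]; rewrite lee_fin charge_le1. Qed.

Lemma open_massU U V : open U -> open V ->
  (open_mass (U `|` V) <= open_mass U + open_mass V)%E.
Proof.
move=> oU oV; apply: ge_ereal_sup => _ [A AUV <-].
(* The part of the basic set of [A] outside [V] is closed and lies in [U], so a basic set separates
   it; its index [C] cuts [A] into a piece inside [U] and a piece inside [V]. *)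
have [||C AVC CU] := @bw_separation (bw_base A `\` V) U _ oU.
- by rewrite setDE; apply: closedI; [exact: bw_closed|exact: open_closedC].
- by move=> p [/AUV[]].
have -> : mu A = mu (A `&` C) + mu (A `\` C).
  by rewrite -muU ?setUIDK// setDE setIACA setICr setI0.
rewrite EFinD; apply: leeD; apply: charge_open_mass.
  by rewrite bw_baseI => p [_ /CU].
by rewrite bw_baseD => p [Ap nCp]; apply: contrapT => nVp; apply/nCp/AVC.
Qed.

Lemma open_mass_bigcup (U : (set betaomega)^nat) : (forall n, open (U n)) ->
  (open_mass (\bigcup_n U n) <= \sum_(n <oo) open_mass (U n))%E.
Proof.
move=> oU; apply: ge_ereal_sup => _ [A AU <-].
have : compact (bw_base A) by apply/bw_closed_compact/bw_closed.
rewrite compact_cover => /(_ _ setT U (fun n _ => oU n) AU)[D _ AD].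
pose N := (\max_(i <- finmap.enum_fset D) i).+1.
have AN : bw_base A `<=` \big[setU/set0]_(i < N) U i.
  rewrite -bigcup_mkord => p /AD[i /= iD Uip]; exists i => //=.
  by rewrite /N ltnS; exact: (@leq_bigmax_seq _ (finmap.enum_fset D) xpredT id).
apply: (le_trans (charge_open_mass AN)).
have fin n : (open_mass (\big[setU/set0]_(i < n) U i) <= \sum_(i < n) open_mass (U i))%E.
  elim: n => [|n IH]; first by rewrite !big_ord0 -bw_base0 open_mass_base charge0.
  rewrite !big_ord_recr /=; apply: le_trans (open_massU _ _) _ => //.
    by rewrite -bigcup_mkord; apply: bigcup_open => i _.
  exact: leeD2r.
apply: (le_trans (fin N)).
rewrite -(big_mkord xpredT (fun n => open_mass (U n))).
by apply: nneseries_lim_ge => n _ _; exact: open_mass_ge0.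
Qed.

Lemma bw_outer_open U : open U -> bw_outer U = open_mass U.
Proof.
move=> oU; apply/eqP; rewrite eq_le; apply/andP; split.
  by apply: ereal_inf_lbound; exists U => //; split.
by apply: le_ereal_inf_tmp => _ [V [_ UV] <-]; exact: le_open_mass.
Qed.

Lemma bw_outer_ge0 S : (0 <= bw_outer S)%E.
Proof. by apply: le_ereal_inf_tmp => _ [U _ <-]; exact: open_mass_ge0. Qed.

Lemma bw_outer_le : {homo bw_outer : S S' / S `<=` S' >-> (S <= S')%E}.
Proof.
move=> S S' SS'; apply: ereal_inf_le_tmp => _ [U [oU S'U] <-].
by exists U => //; split => //; exact: subset_trans S'U.
Qed.

Lemma bw_outer_le1 S : (bw_outer S <= 1)%E.
Proof.
apply: ge_ereal_inf; exists (open_mass setT); last exact: open_mass_le1.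
by exists setT => //; split => //; exact: openT.
Qed.

Lemma bw_outer_fin S : bw_outer S \is a fin_num.
Proof.
by rewrite ge0_fin_numE ?bw_outer_ge0// (le_lt_trans (bw_outer_le1 _))// ltry.
Qed.

Lemma bw_outer_adherent S (e : R) : 0 < e ->
  exists U, [/\ open U, S `<=` U & (bw_outer U < bw_outer S + e%:E)%E].
Proof.
move=> e0; have [_ [U [oU SU] <-] lt] := lb_ereal_inf_adherent e0 (bw_outer_fin S).
by exists U; split => //; rewrite bw_outer_open.
Qed.

Lemma bw_outer0 : bw_outer set0 = 0%E.
Proof. by rewrite -bw_base0 bw_outer_open ?open_mass_base ?charge0//; exact: bw_open. Qed.

Lemma bw_outer_sigma_subadditive : sigma_subadditive bw_outer.
Proof.
move=> F; apply/lee_addgt0Pr => e e0.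
have /choice[U UP] n : exists U, [/\ open U, F n `<=` U &
    (bw_outer U < bw_outer (F n) + (e / (2 ^ n.+1)%:R)%:E)%E].
  by apply: bw_outer_adherent; rewrite divr_gt0// ltr0n expn_gt0.
apply: (@le_trans _ _ (open_mass (\bigcup_n U n))).
  apply: ge_ereal_inf; exists (open_mass (\bigcup_n U n)) => //.
  exists (\bigcup_n U n) => //; split.
    by apply: bigcup_open => n _; case: (UP n).
  by apply: subset_bigcup => n _; case: (UP n).
apply: (le_trans (open_mass_bigcup _)) => [n|]; first by case: (UP n).
apply: (le_trans _ (epsilon_trick xpredT (fun n => bw_outer_ge0 (F n)) (ltW e0))).
apply: lee_nneseries => [n _ _|n _]; first exact: open_mass_ge0.
by have [oU _ /ltW] := UP n; rewrite bw_outer_open.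
Qed.

HB.instance Definition _ := isOuterMeasure.Build R betaomega bw_outer
  bw_outer0 bw_outer_ge0 bw_outer_le bw_outer_sigma_subadditive.

(** An open [W] around [S] replaces [S]. A basic set inside W ∩ U and then one inside the rest of
    [W] are disjoint and lie in [W], so additivity of [mu] bounds the sum of their masses by that of
    [W]. Suprema over both choices give the claim. *)
Lemma open_caratheodory U : open U -> bw_outer.-caratheodory U.
Proof.
move=> oU; apply: le_caratheodory_measurable => S.
apply: le_ereal_inf_tmp => _ [W [oW SW] <-].
apply: (@le_trans _ _ (open_mass (W `&` U) + bw_outer (S `&` ~` U))%E).
  rewrite leeD2r// -bw_outer_open; last exact: openI.
  by apply: bw_outer_le; exact: setSI.
rewrite -leeBrDr ?bw_outer_fin//; apply: ge_ereal_sup => _ [A AWU <-].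
rewrite leeBrDr ?bw_outer_fin//.
apply: (@le_trans _ _ ((mu A)%:E + open_mass (W `\` bw_base A))%E).
  have oWA : open (W `\` bw_base A).
    by rewrite setDE; apply: openI => //; apply: closed_openC; exact: bw_closed.
  rewrite leeD2l// -bw_outer_open//.
  by apply: bw_outer_le => p [/SW Wp nUp]; split => // /AWU[].
rewrite addeC -leeBrDr//; apply: ge_ereal_sup => _ [B BWA <-].
rewrite leeBrDr// -EFinD addrC -muU; last first.
  apply/seteqP; split => // n [An Bn].
  have [] := BWA (omega_pt n); first by rewrite bw_base_omega_pt.
  by rewrite bw_base_omega_pt.
apply: charge_open_mass; rewrite bw_baseU => p [/AWU[]//|/BWA[]//].
Qed.

Lemma borel_caratheodory (S : set BW) : measurable S -> bw_outer.-caratheodory S.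
Proof.
move: S; apply: smallest_sub => [|U]; last exact: open_caratheodory.
split; first exact: caratheodory_measurable_set0.
  by move=> S; rewrite setTD; exact: caratheodory_measurable_setC.
exact: caratheodory_measurable_bigcup.
Qed.

Definition bw_measure (S : set BW) : \bar R := bw_outer S.

Lemma bw_measure_sigma_additive : semi_sigma_additive bw_measure.
Proof.
move=> F mF tF mU.
have mF' n : bw_outer.-cara.-measurable (F n) by exact: borel_caratheodory.
exact: (caratheodory_measure_sigma_additive mF' tF (borel_caratheodory mU)).
Qed.

HB.instance Definition _ := isMeasure.Build _ BW R bw_measure
  bw_outer0 bw_outer_ge0 bw_measure_sigma_additive.

Lemma bw_measure_base A : bw_measure (bw_base A) = (mu A)%:E.
Proof. by rewrite /bw_measure bw_outer_open ?open_mass_base//; exact: bw_open. Qed.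

Lemma bw_measureT : bw_measure setT = 1%E.
Proof. by rewrite -bw_baseT bw_measure_base muT. Qed.

HB.instance Definition _ := Measure_isProbability.Build _ BW R bw_measure bw_measureT.

Lemma measurable_open U : open U -> measurable (U : set BW).
Proof. by move=> oU; apply: sub_sigma_algebra. Qed.

(** Outer regularity read through complements: a nearly optimal open superset of the complement of
    [B] has as its complement a compact subset of [B]. *)
Lemma bw_measure_radon : radon bw_measure.
Proof.
move=> B mB; apply/eqP; rewrite eq_le; apply/andP; split; last first.
  by apply: ge_ereal_sup => _ [K [_ KB] <-]; exact: bw_outer_le.
apply/lee_addgt0Pr => e e0.
have [U [oU nBU ltU]] := bw_outer_adherent (~` B) e0.
have mU := measurable_open oU.
apply: (@le_trans _ _ (bw_measure (~` U) + e%:E)%E).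
  have compl (V : set BW) : measurable V ->
      bw_measure (~` V) = (1 - fine (bw_measure V))%:E.
    by move=> mV; rewrite probability_setC// EFinB fineK//; exact: bw_outer_fin.
  move: ltU; rewrite -[bw_outer (~` B)]/(bw_measure (~` B)) !compl//.
  rewrite -(fineK (bw_outer_fin U)) -[leLHS](fineK (bw_outer_fin B)).
  rewrite -!EFinD lte_fin lee_fin /bw_measure; lra.
rewrite leeD2r//; apply: ereal_sup_ubound; exists (~` U) => //; split.
  by apply: bw_closed_compact; exact: open_closedC.
by move=> p; apply: contra_notP => /nBU.
Qed.

(** The approximation by basic sets serves to carry countable type over to βω: an open superset of
    [S] and a basic set inside that superset cost [e / 2] each. *)
Lemma stone_representation : exists nu : probability BW R,
  [/\ radon nu, forall A, nu (bw_base A) = (mu A)%:E &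
    forall S : set BW, measurable S -> forall e : R, 0 < e ->
      exists A, (nu (S `+` bw_base A) < e%:E)%E].
Proof.
exists bw_measure; split; [exact: bw_measure_radon|exact: bw_measure_base|].
move=> S mS e e0; have e2 : 0 < e / 2 by rewrite divr_gt0.
have [U [oU SU ltU]] := bw_outer_adherent S e2.
have mU := measurable_open oU.
have fU : open_mass U \is a fin_num by rewrite -bw_outer_open// bw_outer_fin.
have [_ [A AU <-] ltA] := ub_ereal_sup_adherent e2 fU.
have mA : measurable (bw_base A : set BW) by apply: measurable_open; exact: bw_open.
exists A; apply: (@le_lt_trans _ _
  (bw_measure (U `\` S) + bw_measure (U `\` bw_base A))%E).
  apply: le_trans (measureU2 _ _ _); [|exact: measurableD..].
  apply: le_measure; rewrite ?inE.
  - by apply: measurableU; exact: measurableD.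
  - by apply: measurableU; exact: measurableD.
  - move=> p [[Sp nAp]|[Ap nSp]]; first by right; split => //; exact: SU.
    by left; split => //; exact: AU.
have fS : bw_measure S \is a fin_num by exact: bw_outer_fin.
have US : U `&` S = S by apply/setIidPr.
have UA : U `&` bw_base A = bw_base A by apply/setIidPr.
have lt1 : (bw_measure (U `\` S) < (e / 2)%:E)%E.
  rewrite measureD ?US//; last by rewrite ltey_eq bw_outer_fin.
  by rewrite lteBlDl.
have lt2 : (bw_measure (U `\` bw_base A) < (e / 2)%:E)%E.
  have -> : bw_measure (U `\` bw_base A) = (open_mass U - (mu A)%:E)%E.
    rewrite -bw_outer_open// -bw_measure_base -[bw_outer U]/(bw_measure U) -[in RHS]UA.
    by apply: measureD => //; rewrite ltey_eq bw_outer_fin.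
  by move: ltA; rewrite !lteBlDr// addeC.
by rewrite [e]splitr EFinD; exact: lteD.
Qed.

End StoneRepresentation.

(** * Countable dense subsets of L1 *)

Section L1Separable.
Import HBSimple.
Context (d : measure_display) (T : measurableType d) (R : realType).
Variable P : probability T R.
Variable E : (set T)^nat.
Hypothesis mE : forall n, measurable (E n).
Hypothesis denseE : forall A, measurable A ->
  forall e : R, 0 < e -> exists n, (P (A `+` E n) < e%:E)%E.

Let L1norm (u : T -> R) : \bar R := \int[P]_x `|(u x)%:E|.

Let measurable_abs (u : T -> R) : measurable_fun setT u ->
  measurable_fun setT (fun x => `|(u x)%:E|%E).
Proof. by move=> mu; apply: measurableT_comp => //; exact/measurable_EFinP. Qed.

Let L1normD (u v : T -> R) : measurable_fun setT u -> measurable_fun setT v ->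
  (L1norm (u \+ v)%R <= L1norm u + L1norm v)%E.
Proof.
move=> mu mv; rewrite /L1norm -ge0_integralD//; [|exact: measurable_abs..].
apply: ge0_le_integral => //.
- by apply: measurable_abs; exact: measurable_funD.
- by apply: emeasurable_funD; exact: measurable_abs.
- by move=> x _; rewrite EFinD; exact: lee_abs_add.
Qed.

Definition rat_simple (s : seq (rat * nat)) (x : T) : R :=
  \sum_(qn <- s) ratr qn.1 * \1_(E qn.2) x.

Lemma integrable_rat_simple s : P.-integrable setT (EFin \o rat_simple s).
Proof.
elim: s => [|[q n] s IH].
  rewrite (_ : _ \o _ = cst 0%E); first exact: integrable0.
  by apply/funext => x; rewrite /= /rat_simple big_nil.
rewrite (_ : _ \o _ =
  (fun x => (ratr q)%:E * (\1_(E n) x)%:E) \+ (EFin \o rat_simple s))%E.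
  apply: integrableD => //; apply: integrableZl => //.
  by apply: integrable_indic => //; rewrite ltey_eq fin_num_measure.
by apply/funext => x; rewrite /= /rat_simple big_cons EFinD EFinM.
Qed.

Definition rat_approximable (f : T -> R) := measurable_fun setT f /\
  forall e : R, 0 < e -> exists s, (L1norm (f \- rat_simple s)%R < e%:E)%E.

Let measurable_rat_simple s : measurable_fun setT (rat_simple s).
Proof. by apply/measurable_EFinP; case/integrableP: (integrable_rat_simple s). Qed.

Lemma rat_approximable0 : rat_approximable (cst 0).
Proof.
split=> // e e0; exists [::]; rewrite /L1norm integral0_eq ?lte_fin// => x _.
by rewrite /= /rat_simple big_nil subrr normr0.
Qed.

Lemma rat_approximableD f g :
  rat_approximable f -> rat_approximable g -> rat_approximable (f \+ g)%R.
Proof.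
move=> [mf hf] [mg hg]; split=> [|e e0]; first exact: measurable_funD.
have e2 : 0 < e / 2 by rewrite divr_gt0.
have [s hs] := hf _ e2; have [t ht] := hg _ e2; exists (s ++ t).
rewrite [e]splitr EFinD; apply: le_lt_trans (lteD hs ht).
apply: le_trans (L1normD _ _); last 2 first.
- exact: measurable_funB.
- exact: measurable_funB.
rewrite le_eqVlt; apply/orP; left; apply/eqP; congr L1norm; apply/funext => x /=.
by rewrite {1}/rat_simple big_cat /=; rewrite opprD addrACA.
Qed.

Lemma rat_approximable_indic A (r : R) : measurable A ->
  rat_approximable (fun x => r * \1_A x).
Proof.
move=> mA; split=> [|e e0].
  by apply: measurable_funM => //; exact: measurable_indic.
have e2 : 0 < e / 2 by rewrite divr_gt0.
have [q] : exists q : rat, ratr q \in `]r - e / 2, r + e / 2[.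
  by apply: rat_in_itvoo; lra.
rewrite in_itv /= => /andP[q1 q2].
have q0 : 0 < `|ratr q| + 1 :> R by rewrite ltr_pwDr.
have [n hn] := denseE mA (divr_gt0 e2 q0).
have mY : measurable (A `+` E n) by apply: measurableU; exact: measurableD.
exists [:: (q, n)].
(* Pointwise, the error is at most |r - q| where x lies in both sets or in neither, and at most |r -
   q| + |q| on the symmetric difference. The extra 1 keeps the divisor in the choice of [E n]
   positive. *)
apply: (@le_lt_trans _ _ (\int[P]_x ((`|r - ratr q|)%:E +
    (`|ratr q| + 1)%:E * (\1_(A `+` E n) x)%:E)))%E.
  apply: ge0_le_integral => //.
  - apply: measurable_abs; apply: measurable_funB => //.
    by apply: measurable_funM => //; exact: measurable_indic.
  - apply: emeasurable_funD => //; apply: emeasurable_funM => //.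
    by apply/measurable_EFinP; exact: measurable_indic.
  move=> x _; rewrite -EFinM -EFinD lee_fin /= /rat_simple big_seq1 /=.
  rewrite !indicE /setY in_setU !in_setD.
  have rq : `|r| <= `|r - ratr q| + `|ratr q|.
    by rewrite -[in leLHS](subrK (ratr q) r) ler_normD.
  have [rq0 q0'] := (normr_ge0 (r - ratr q), normr_ge0 (ratr q : R)).
  by case: (x \in A); case: (x \in E n);
    rewrite /= ?(mulr1, mulr0, subr0, sub0r, normrN, normr0); lra.
have mY1 : measurable_fun setT (EFin \o \1_(A `+` E n) : T -> \bar R).
  by apply/measurable_EFinP; exact: measurable_indic.
rewrite ge0_integralD//; last exact: emeasurable_funM.
rewrite integral_cst// ge0_integralZl//.
rewrite integral_indic// setIT [e]splitr [ltRHS]EFinD; apply: lteD.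
  apply: (@le_lt_trans _ _ (`|r - ratr q|%:E * 1)%E).
    by apply: lee_wpmul2l => //; exact: probability_le1.
  by rewrite mule1 lte_fin ltr_norml; lra.
by rewrite muleC -lte_pdivlMr// -EFinM.
Qed.

Lemma rat_approximable_sfun (h : {sfun T >-> R}) : rat_approximable h.
Proof.
pose s := finmap.enum_fset (fset_set (range h)).
have -> : (h : T -> R) =
    \sum_(i < size s) (fun x => s`_i * \1_(h @^-1` [set s`_i]) x).
  by apply/funext => x; rewrite fct_sumE; exact: fimfunEord.
elim/big_ind: _ => [|f g|i _]; first exact: rat_approximable0.
  exact: rat_approximableD.
by apply: rat_approximable_indic; exact: measurable_funPTI.
Qed.

Lemma L1_rat_simple_dense (f : T -> R) : P.-integrable setT (EFin \o f) ->
  forall e : R, 0 < e -> exists s, (\int[P]_x `|(f x - rat_simple s x)%:E| < e%:E)%E.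
Proof.
move=> intf e e0; have e2 : 0 < e / 2 by rewrite divr_gt0.
have mf : measurable_fun setT f by apply/measurable_EFinP; case/integrableP: intf.
have [h [_ _ /fine_cvgP[fin hf]]] := approximation_sfun_integrable measurableT intf.
have [n [finn hn]] : exists n, L1norm (f \- h n)%R \is a fin_num /\
    fine (L1norm (f \- h n)%R) < e / 2.
  have lt : \forall k \near \oo, fine (L1norm (f \- h k)%R) < e / 2.
    by move/cvgr_lt: hf; exact.
  have [n _ /(_ n (leqnn n))[]] := filterI fin lt.
  by exists n.
have [_ /(_ _ e2)[s hs]] := rat_approximable_sfun (h n).
exists s; rewrite [e]splitr EFinD.
have {}hn : (L1norm (f \- h n)%R < (e / 2)%:E)%E by rewrite -(fineK finn) lte_fin.
apply: le_lt_trans (lteD hn hs).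
apply: le_trans (L1normD _ _); last 2 first.
- exact: measurable_funB.
- exact: measurable_funB.
rewrite le_eqVlt; apply/orP; left; apply/eqP; congr L1norm; apply/funext => x /=.
by rewrite addrA subrK.
Qed.

End L1Separable.

Lemma L1_separable_dense (R : realType) (nu : probability BW R) (E : (set BW)^nat) :
  (forall n, measurable (E n)) ->
  (forall A, measurable A -> forall e : R, 0 < e ->
    exists n, (nu (A `+` E n) < e%:E)%E) ->
  L1_separable nu.
Proof.
move=> mE denseE; exists (range (rat_simple R E)); split.
- exact: sub_countable (card_image_le _ _) (countableP _).
- by move=> _ [s _ <-]; exact: integrable_rat_simple.
- move=> f intf e e0; have [s hs] := L1_rat_simple_dense mE denseE intf e0.
  by exists (rat_simple R E s) => //; exists s.
Qed.

(** * From a join-preserving map to a Radon measure of countable type *)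

Section RadonFromJoinHomomorphism.
Context (d : measure_display) (T : measurableType d) (R : realType).
Variables (P : probability T R) (G : (set T)^nat) (Phi0 : set nat -> set T).
Hypothesis genG : @measurable d T = <<s range G>>.
Hypothesis mPhi0 : forall A, measurable (Phi0 A).
Hypothesis Phi0U : forall A B, Phi0 (A `|` B) = Phi0 A `|` Phi0 B.
Hypothesis Phi0_setT : Phi0 setT = setT.
Hypothesis Phi0_set0 : Phi0 set0 = set0.

(** A Boolean homomorphism [Phi] below [Phi0] makes A ↦ P (Phi A) a charge, and the Stone measure of
    this charge inherits the bound by [Phi0] and separability. *)
Lemma radon_below_join_hom : exists nu : probability BW R,
  [/\ radon nu, L1_separable nu &
    forall A, (nu (bw_base A) <= P (Phi0 A))%E].
Proof.
have [Phi [[mPhi PhiPhi0 PhiT PhiS PhiU] PhiI]] :=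
  boolean_hom_below P mPhi0 Phi0U Phi0_setT.
pose mu A : R := fine (P (Phi A)).
have muE A : (mu A)%:E = P (Phi A) by rewrite fineK// fin_num_measure.
have Phi_set0 : aesub P (Phi set0) set0 by rewrite -Phi0_set0; exact: PhiPhi0.
have Phi_disj A B : A `&` B = set0 -> aesub P (Phi A `&` Phi B) set0.
  by move=> AB; apply: aesub_trans (PhiI A B) _; rewrite AB.
have mu_ge0 A : 0 <= mu A by rewrite fine_ge0.
have muT : mu setT = 1.
  rewrite /mu (_ : P _ = 1%E)// -(probability_setT P).
  by apply: measure_aesub_eq => //; exact: aesubS.
have muU A B : A `&` B = set0 -> mu (A `|` B) = mu A + mu B.
  move=> AB; apply: EFin_inj; rewrite EFinD !muE.
  have mAB := measurableU _ _ (mPhi A) (mPhi B).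
  rewrite (measure_aesub_eq _ mAB (PhiU A B))//; last first.
    by apply: aesubUl => //; rewrite setUC; exact: PhiS.
  rewrite measureUfinl ?ltey_eq ?fin_num_measure//.
  have mI := measurableI _ _ (mPhi A) (mPhi B).
  have := Phi_disj _ _ AB; rewrite /aesub setD0 => /(measure_negligible mI) ->.
  by rewrite sube0.
have [nu [nu_radon nuE nu_approx]] := stone_representation mu_ge0 muT muU.
have mbase A : measurable (bw_base A : set BW).
  by apply: measurable_open; exact: bw_open.
exists nu; split => [//||A]; last first.
  by rewrite nuE muE; exact: le_measure_aesub.
(* Basic sets are at most as far apart as their images, since [Phi] of a difference lies almost
   inside the difference of the values. *)
have le_nuY A B : (nu (bw_base A `+` bw_base B) <= P (Phi A `+` Phi B))%E.
  rewrite /setY -!bw_baseD -bw_baseU nuE muE.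
  apply: le_measure_aesub => //; first exact: (measurableY (mPhi A) (mPhi B)).
  apply: aesub_trans (PhiU _ _) _; apply: aesubUl.
    have hD : aesub P (Phi (A `\` B)) (Phi A).
      by rewrite -[in Phi A](setUidr (@subDsetl _ A B)); exact: PhiS.
    have hI : aesub P (Phi (A `\` B) `&` Phi B) set0.
      by apply: Phi_disj; rewrite setDE -setIA setICl setI0.
    apply: (aesub2 hD hI) => x [h1 /not_orP[h2 _]].
    have [hB|hB] := pselect (Phi B x); first by right; split.
    by left; split => // hA; apply: h2; split.
  have hD : aesub P (Phi (B `\` A)) (Phi B).
    by rewrite -[in Phi B](setUidr (@subDsetl _ B A)); exact: PhiS.
  have hI : aesub P (Phi (B `\` A) `&` Phi A) set0.
    by apply: Phi_disj; rewrite setDE -setIA setICl setI0.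
  apply: (aesub2 hD hI) => x [h1 /not_orP[_ h2]].
  have [hA|hA] := pselect (Phi A x); first by right; split.
  by left; split => // hB; apply: h2; split.
have [E [mE denseE]] := measure_algebra_separable P genG.
(* The dense sets [E n] need not be values of [Phi]. As for any subset of a separable metric space,
   one value within 1/(k+1) of [E n] is picked for each pair, with [set0] as default when there is
   none. *)
have /choice[C CP] (nk : nat * nat) : exists C : set nat,
    (exists A, (P (Phi A `+` E nk.1) < (nk.2.+1%:R^-1)%:E)%E) ->
    (P (Phi C `+` E nk.1) < (nk.2.+1%:R^-1)%:E)%E.
  have [[A hA]|nA] := pselect (exists A, (P (Phi A `+` E nk.1) < (nk.2.+1%:R^-1)%:E)%E).
    by exists A.
  by exists set0 => /nA.
pose F n : set BW := bw_base (C (odflt (0%N, 0%N) (unpickle n))).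
apply: (@L1_separable_dense _ nu F) => [n|S mS e e0]; first exact: mbase.
have e2 : 0 < e / 2 by rewrite divr_gt0.
have e4 : 0 < e / 2 / 2 by rewrite divr_gt0.
have [A hA] := nu_approx S mS _ e2.
have [k] := ltr_add_invr e4; rewrite add0r => ke.
have k0 : 0 < k.+1%:R^-1 :> R by rewrite invr_gt0.
have [n hn] := denseE _ (mPhi A) _ k0.
exists (pickle (n, k)); rewrite /F pickleK /=.
have hC : (P (Phi (C (n, k)) `+` E n) < (k.+1%:R^-1)%:E)%E.
  by apply: (CP (n, k)); exists A.
have kE : ((k.+1%:R^-1)%:E <= (e / 2 / 2)%:E)%E by rewrite lee_fin ltW.
apply: (le_lt_trans (measureY_triangle _ mS (mbase A) (mbase _))).
(* Error budget: [e / 2] from [S] to the basic set of [A], then e/4 from [Phi A] to [E n] and e/4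
   from [E n] to [Phi (C (n, k))]. *)
rewrite [e]splitr [ltRHS]EFinD; apply: lteD => //.
apply: (le_lt_trans (le_nuY _ _)).
apply: (le_lt_trans (measureY_triangle _ (mPhi A) (mE n) (mPhi _))).
rewrite [e / 2]splitr [ltRHS]EFinD; apply: lteD; first exact: lt_le_trans kE.
by rewrite setYC; exact: lt_le_trans kE.
Qed.

End RadonFromJoinHomomorphism.

(** * The binary tree and its branches *)

Section BinaryTree.
Local Open Scope nat_scope.

(* The nodes of the binary tree are the positive integers, the node j having
   the children 2j and 2j+1; level k consists of the j with 2^k <= j < 2^(k+1). *)
Definition descendants (j : nat) : set nat := [set m | exists d, m %/ 2 ^ d = j].

Lemma descendant_at_level k m : 2 ^ k <= m ->
  exists2 j, 2 ^ k <= j < 2 ^ k.+1 & descendants j m.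
Proof.
move=> km; set e := trunc_log 2 m.
have m0 : 0 < m by apply: leq_trans km; rewrite expn_gt0.
have ke : k <= e by exact: trunc_log_max.
have /andP[em me] : 2 ^ e <= m < 2 ^ e.+1 by exact: trunc_log_bounds.
(* The ancestor of [m] at level [k]: [m] lies at level [e], and the division drops its last [e - k]
   binary digits. *)
exists (m %/ 2 ^ (e - k)); last by exists (e - k).
rewrite leq_divRL ?expn_gt0// ltn_divLR ?expn_gt0// -!expnD.
by rewrite addSn subnKC// em.
Qed.

(** The descendants of [j] that lie [d] levels lower form a block of 2^d consecutive integers; after
    rescaling, this block becomes a dyadic interval. *)
Lemma descendant_level k n j m : 2 ^ k <= j < 2 ^ k.+1 -> 2 ^ n <= m < 2 ^ n.+1 ->
  descendants j m -> exists2 d, n = (k + d) & j * 2 ^ d <= m < j.+1 * 2 ^ d.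
Proof.
move=> /andP[kj jk] /andP[nm mn] [d md]; exists d; last first.
  rewrite -[j]md; have := ltn_ceil m (expn_gt0 2 d : 0 < 2 ^ d).
  by rewrite leq_trunc_div => ->.
apply/eqP; rewrite eqn_leq; apply/andP; split; rewrite -ltnS -(ltn_exp2l _ _ (ltnSn 1)).
  apply: leq_ltn_trans nm _; rewrite -addSn expnD.
  by rewrite -ltn_divLR ?expn_gt0// md.
apply: leq_ltn_trans mn; rewrite expnD.
by rewrite -leq_divRL ?expn_gt0// md.
Qed.

Lemma bw_base_set1 n : bw_base [set n] = [set omega_pt n].
Proof.
apply/seteqP; split => [[F FU]|p ->]; last by rewrite bw_base_omega_pt.
rewrite /bw_base /= => Fn; apply: eq_exist.
have [_ maxn] := principal_filter_ultra n.
apply: maxn => A /principal_filterP An.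
by apply: filterS Fn => m ->.
Qed.

Lemma remainderP (p : betaomega) : remainder p <-> forall n, ~ bw_base [set n] p.
Proof.
split=> [rp n|h [n _ np]].
  by rewrite bw_base_set1 => pn; apply: rp; exists n.
by apply: (h n); rewrite bw_base_set1.
Qed.

Lemma bw_base_cofinite (p : betaomega) k :
  remainder p -> bw_base [set m | k <= m] p.
Proof.
move=> /remainderP rp; have FU := svalP p; pose F := sval p.
have h (i : 'I_k) : F (~` [set (i : nat)]).
  by have [/rp|] := in_ultra_setVsetC [set (i : nat)] FU.
apply: filterS (filter_forall _ h) => m hm /=; rewrite leqNgt; apply/negP => mk.
exact: (hm (Ordinal mk)).
Qed.

(** The vertices from level [k] on are cofinitely many, hence form a member of every ultrafilter in
    the remainder. The finitely many descendant sets of level [k] cover them, so one of these sets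
    is a member too. *)
Lemma bw_base_descendants (p : betaomega) k : remainder p ->
  exists2 j, 2 ^ k <= j < 2 ^ k.+1 & bw_base (descendants j) p.
Proof.
case: p => F FU rp; apply: contrapT => np.
have h (i : 'I_(2 ^ k.+1)) : F [set m | 2 ^ k <= i -> ~ descendants i m].
  have [ki|ki] := boolP (2 ^ k <= i); last first.
    by apply: (@filterS _ F _ setT); [move=> m _|exact: filterT].
  apply: (@filterS _ F _ (~` descendants i)); first by move=> m hm _.
  have [|//] := in_ultra_setVsetC (descendants i) FU.
  by move=> hi; case: np; exists (i : nat) => //; rewrite ki ltn_ord.
have h' : F [set m | forall i : 'I_(2 ^ k.+1), 2 ^ k <= i -> ~ descendants i m].
  exact: filter_forall h.
have hc : F [set m | 2 ^ k <= m] := bw_base_cofinite (2 ^ k) rp.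
apply: (@filter_not_empty _ F); apply: filterS (filterI hc h').
move=> m [/descendant_at_level[j /andP[kj jk] jm] nm].
by apply: (nm (Ordinal jk)).
Qed.

End BinaryTree.

(** * Real numbers as branches of the binary tree *)

Section DyadicBranch.
Variable R : realType.
Implicit Types (A : set nat) (t : R).

(* For 1 <= t < 2, branch n t is the vertex at level n of the branch given by
   the binary expansion of t. *)
Definition branch (n : nat) (t : R) : nat := Num.truncn (2 ^+ n * t).

(** The map Φ0. It is defined on the whole line, so that ω goes exactly to [setT]; the restriction
    to [1,2) is left to the measure. *)
Definition branch_limsup A : set R := lim_sup_set (fun n => [set t | A (branch n t)]).

Lemma branch_limsupP A t :
  branch_limsup A t <-> forall n, exists2 j, (n <= j)%N & A (branch j t).
Proof. by split=> [h n|h n _]; [have [j] := h n I|have [j] := h n]; exists j. Qed.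

Lemma branch_limsupU A B : branch_limsup (A `|` B) = branch_limsup A `|` branch_limsup B.
Proof.
apply/seteqP; split => t.
  rewrite /setU /= !branch_limsupP => h; apply: contrapT => /not_orP[].
  move=> /existsNP[n hn] /existsNP[m hm].
  have [j nmj [Aj|Bj]] := h (maxn n m).
    by apply: hn; exists j => //; apply: leq_trans nmj; exact: leq_maxl.
  by apply: hm; exists j => //; apply: leq_trans nmj; exact: leq_maxr.
by move=> [] /branch_limsupP h; apply/branch_limsupP => n; have [j nj Aj] := h n;
  exists j => //; [left|right].
Qed.

Lemma branch_limsup_setT : branch_limsup setT = setT.
Proof. by apply/seteqP; split => // t _; apply/branch_limsupP => n; exists n. Qed.

Lemma branch_limsup_set0 : branch_limsup set0 = set0.
Proof. by apply/seteqP; split => // t /branch_limsupP /(_ 0%N)[]. Qed.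

(** Sublevel sets of [branch n] are half-lines, because the truncation of x is at most m exactly
    when x < m + 1, negative x included. *)
Lemma measurable_branch_limsup A : measurable (branch_limsup A).
Proof.
have mle n m : measurable [set t | (branch n t <= m)%N].
  rewrite (_ : [set t | _] = `]-oo, (m.+1%:R / 2 ^+ n : R)[%classic).
    exact: measurable_itv.
  apply/seteqP; split => t /=; rewrite in_itv /= truncn_le_nat;
    by rewrite ltr_pdivlMr ?exprn_gt0// mulrC.
apply: bigcapT_measurable => n; apply: bigcup_measurable => j _.
rewrite (_ : [set t | _] = \bigcup_(m in A) [set t | branch j t = m]); last first.
  apply/seteqP; split => [t At|t [m Am /= jm]]; last by rewrite jm.
  by exists (branch j t).
apply: bigcup_measurable => -[|m] _.
  rewrite (_ : [set t | _] = [set t | (branch j t <= 0)%N])//.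
  by apply/seteqP; split => t /=; rewrite leqn0 => /eqP.
rewrite (_ : [set t | _] =
  [set t | (branch j t <= m.+1)%N] `\` [set t | (branch j t <= m)%N]).
  exact: measurableD.
apply/seteqP; split => t /=; first by move=> ->; split => //; rewrite ltnn.
by move=> [h1 /negP]; rewrite -ltnNge => h2; apply/eqP; rewrite eqn_leq h1.
Qed.

Lemma branch_level n t : t \in `[1, 2[ -> (2 ^ n <= branch n t < 2 ^ n.+1)%N.
Proof.
rewrite in_itv /= => /andP[t1 t2].
have p0 : 0 < 2 ^+ n :> R by rewrite exprn_gt0.
rewrite truncn_ge_nat ?truncn_lt_nat ?natrX ?exprS; [|nra|nra].
apply/andP; split; nra.
Qed.

(** At a level j ≥ n every vertex is at least 2^j > n, so a branch from [1,2) cannot meet [n]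
    there. *)
Lemma branch_limsup_set1 n : branch_limsup [set n] `&` `[1, 2[%classic = set0.
Proof.
rewrite -subset0 => t [/branch_limsupP /(_ n)[j nj /= pj] /(branch_level j)].
rewrite pj => /andP[jn _]; have := leq_ltn_trans nj (ltn_expl j (ltnSn 1)).
by rewrite ltnNge jn.
Qed.

Lemma branch_descendants k j n t : (2 ^ k <= j < 2 ^ k.+1)%N -> t \in `[1, 2[ ->
  descendants j (branch n t) -> t \in `[j%:R / 2 ^+ k, j.+1%:R / 2 ^+ k[.
Proof.
move=> kj t12 jp.
have [d nkd /andP[jd dj]] := descendant_level kj (branch_level n t12) jp.
have t0 : 0 <= t by move: t12; rewrite in_itv /= => /andP[t1 _]; lra.
have p0 (m : nat) : 0 < 2 ^+ m :> R by rewrite exprn_gt0.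
have x0 : 0 <= 2 ^+ n * t by rewrite mulr_ge0// ltW.
move: jd dj; rewrite truncn_ge_nat// truncn_lt_nat// !natrM !natrX nkd exprD.
rewrite -mulrA [_ ^+ d * t]mulrC mulrA ler_pM2r// ltr_pM2r// => h1 h2.
by rewrite in_itv /= ler_pdivrMr// ltr_pdivlMr// mulrC h1.
Qed.

End DyadicBranch.

(** * Lebesgue measure on [1,2) and the sets of branches *)

Section LebesgueOnUnitInterval.
Variable R : realType.

Definition lebesgue12 : set (measurableTypeR R) -> \bar R :=
  mrestr (@lebesgue_measure R) (measurable_itv `[1, 2[).

HB.instance Definition _ := Measure.on lebesgue12.

Lemma lebesgue12_setT : lebesgue12 setT = 1%E.
Proof.
rewrite /lebesgue12 /mrestr setTI lebesgue_measure_itv /= lte_fin ltr1n.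
by rewrite -EFinB; congr (_%:E); lra.
Qed.

HB.instance Definition _ :=
  Measure_isProbability.Build _ (measurableTypeR R) R lebesgue12 lebesgue12_setT.

Definition rational_ray (n : nat) : set (measurableTypeR R) :=
  `]ratr (odflt 0 (unpickle n : option rat)), +oo[%classic.

Lemma measurable_rational_rays :
  @measurable _ (measurableTypeR R) = <<s range rational_ray>>.
Proof.
apply/seteqP; split; last first.
  apply: smallest_sub; first exact: sigma_algebra_measurable.
  by move=> _ [n _ <-]; exact: measurable_itv.
rewrite [X in X `<=` _]RGenOInfty.measurableE.
apply: smallest_sub; first exact: smallest_sigma_algebra.
move=> _ [x ->].
pose D := [set n | x < ratr (odflt 0 (unpickle n : option rat))].
rewrite (_ : `]x, +oo[%classic = \bigcup_n (if n \in D then rational_ray n else set0)).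
  apply: sigma_algebra_bigcup => n; case: ifP => _; last exact: sigma_algebra0.
  by apply: sub_sigma_algebra; exists n.
apply/seteqP; split => y /=; rewrite in_itv /= andbT.
  move=> /rat_in_itvoo[q]; rewrite in_itv /= => /andP[xq qy].
  have Dq : D (pickle q) by rewrite /D /mkset pickleK.
  exists (pickle q) => //; rewrite mem_set// /rational_ray pickleK [odflt _ _]/= set_itvE.
  exact: qy.
move=> [n _]; case: ifP => // /set_mem xn; rewrite /rational_ray /= in_itv /= andbT.
exact: lt_trans.
Qed.

Lemma lebesgue12_branch_limsup_set1 n : lebesgue12 (branch_limsup [set n]) = 0%E.
Proof. by rewrite /lebesgue12 /mrestr branch_limsup_set1 measure0. Qed.

Lemma lebesgue12_branch_limsup_descendants (m : nat) (j : nat -> nat) :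
  (forall k, (2 ^ (k + m.+1) <= j k < 2 ^ (k + m.+1).+1)%N) ->
  (lebesgue12 (branch_limsup (\bigcup_k descendants (j k))) <= (2 ^- m)%:E)%E.
Proof.
move=> hj; pose I k : set (measurableTypeR R) :=
  `[(j k)%:R / 2 ^+ (k + m.+1), (j k).+1%:R / 2 ^+ (k + m.+1)[%classic.
have mI k : measurable (I k) by exact: measurable_itv.
have mU : measurable (\bigcup_k I k) by exact: bigcupT_measurable.
have p0 k : 0 < 2 ^+ (k + m.+1) :> R by rewrite exprn_gt0.
(* The length 2^-(k+m+1) is written as 2^-m divided by 2^(k+1), the shape summed by
   [epsilon_trick0], so that the total is at most 2^-m. *)
have IE k : lebesgue_measure (I k) = ((2 ^- m) / (2 ^ k.+1)%:R)%:E.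
  rewrite /I lebesgue_measure_itv /= lte_fin ltr_pM2r ?invr_gt0// ltr_nat ltnSn.
  rewrite -EFinB -mulrBl -natrB ?leqnSn// subSnn mul1r natrX -invfM -exprD.
  by rewrite !addnS addnC.
apply: (@le_trans _ _ (lebesgue_measure (\bigcup_k I k))).
  apply: le_measure; rewrite ?inE//.
    by apply: measurableI; [exact: measurable_branch_limsup|exact: measurable_itv].
  (* A single meeting suffices: a branch through a descendant of [j k] passes through [j k], so [t]
     lies in the interval of that vertex. *)
  move=> t [/branch_limsupP /(_ 0%N)[n _ [k _ hk]] t12].
  by exists k => //; exact: branch_descendants (hj k) t12 hk.
apply: (le_trans (generalized_Boole_inequality (@lebesgue_measure R) mI mU)).
apply: le_trans (epsilon_trick0 xpredT _); last by rewrite invr_ge0 exprn_ge0.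
by apply: lee_nneseries => // k _; rewrite -IE.
Qed.

End LebesgueOnUnitInterval.

Theorem theorem3p2 (R : realType) :
  exists nu : probability BW R,
    [/\ radon nu,
        L1_separable nu,
        nu remainder = 1%E &
        forall F : set betaomega,
          F `<=` remainder -> closed F -> separable_set F -> nu F = 0%E].
Proof.
have [nu [nu_radon nu_sep nu_le]] := radon_below_join_hom (@lebesgue12 R)
  (@measurable_rational_rays R) (@measurable_branch_limsup R) (@branch_limsupU R)
  (@branch_limsup_setT R) (@branch_limsup_set0 R).
exists nu; split => //.
  have mbase n : measurable (bw_base [set n] : set BW).
    by apply: measurable_open; exact: bw_open.
  have omegaE : omega_in_bw = \bigcup_n bw_base [set n].
    apply/seteqP; split => [_ [n _ <-]|p [n _]].
      by exists n => //; rewrite bw_base_set1.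
    by rewrite bw_base_set1 => ->; exists n.
  have mU : measurable (\bigcup_n bw_base [set n] : set BW) by exact: bigcupT_measurable.
  have nu_omega : nu (\bigcup_n bw_base [set n]) = 0%E.
    apply: measure_negligible => //; apply: negligible_bigcup => n.
    apply/negligibleP => //; apply/eqP; rewrite -measure_le0.
    by rewrite -(lebesgue12_branch_limsup_set1 R n); exact: nu_le.
  by rewrite /remainder omegaE probability_setC// nu_omega sube0.
move=> F Frem cF [D [DF /countable_injP[g ginj] FD]].
have mF : measurable (F : set BW).
  by rewrite -[F]setCK; apply: measurableC; apply: measurable_open; exact: closed_openC.
apply/eqP; rewrite -measure_le0; apply/lee_addgt0Pr => e e0; rewrite add0e.
have [m me] : exists m, 2 ^- m <= e :> R.
  have [m] := ltr_add_invr e0; rewrite add0r => /ltW me; exists m.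
  apply: le_trans me; rewrite lef_pV2 ?posrE// ?exprn_gt0//.
  by rewrite -natrX ler_nat ltn_expl.
(* [D] is enumerated through the injection [g]; an index [k] that codes no point of [D] receives the
   first vertex of its level, which keeps the level bound that the measure estimate asks for. *)
have /choice[j hj] k : exists j, (2 ^ (k + m.+1) <= j < 2 ^ (k + m.+1).+1)%N /\
    forall p, D p -> g p = k -> bw_base (descendants j) p.
  have [[p [Dp gp]]|nD] := pselect (exists p, D p /\ g p = k).
    have [j hj jp] := bw_base_descendants (k + m.+1) (Frem p (DF p Dp)).
    exists j; split => // q Dq gq.
    by rewrite (ginj q p) ?inE// gq.
  exists (2 ^ (k + m.+1))%N; rewrite leqnn ltn_exp2l// ltnSn; split => // p Dp gp.
  by case: nD; exists p.
pose A := \bigcup_k descendants (j k).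
(* Basic sets are closed, so containing [D] is enough to contain its closure. *)
have FA : F `<=` bw_base A.
  apply: subset_trans FD _; rewrite closureE; apply: smallest_sub; first exact: bw_closed.
  move=> p Dp; have [_ /(_ p Dp erefl)] := hj (g p).
  by apply: bw_base_mono => n hn; exists (g p).
apply: (@le_trans _ _ (nu (bw_base A))).
  by apply: le_measure; rewrite ?inE//; apply: measurable_open; exact: bw_open.
apply: (le_trans (nu_le A)).
apply: (@le_trans _ _ (2 ^- m)%:E); last by rewrite lee_fin.
by apply: lebesgue12_branch_limsup_descendants => k; case: (hj k).
Qed.
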